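(* Let $n\ge2$ and let $G$ be the free group on $u_1,\dots,u_n$. Let $b=-1/(n-1)$, and define $\phi$ on $G$ by $\phi(s)=b^{\gamma(s)}$ if $|s|=2\gamma(s)$, and $\phi(s)=0$ otherwise. Then $\phi$ is positive definite. Furthermore, zero is the only eigenvalue of $u_1+\cdots+u_n$ in the cyclic unitary representation of $G$ on Hilbert space to which $\phi$ gives rise, and the eigenspace is one-dimensional.
   Context: For $s\in G$ (a reduced word in $u_1^{\pm1},\dots,u_n^{\pm1}$), $|s|$ is its length and $\gamma(s)$ is the number of positions where a letter $u_i^{-1}$ is immediately followed by a letter $u_j$ (number of negative-to-positive exponent changes from left to right). The cyclic unitary representation to which $\phi$ gives rise is the GNS representation: the unitary representation $\pi$ with a cyclic unit vector $\xi$ such that $\phi(s)=\langle\pi(s)\xi,\xi\rangle$ for $s\in G$; the eigenvalues meant are those of the operator $\pi(u_1)+\cdots+\pi(u_n)$. *)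

(* Defs.v *)
From HB Require Import structures.
From mathcomp Require Import all_boot all_order all_algebra.
From mathcomp Require Import sesquilinear complex.
From mathcomp Require Import all_classical all_reals all_analysis.

Set Implicit Arguments.
Unset Strict Implicit.
Unset Printing Implicit Defensive.

Import Order.TTheory GRing.Theory Num.Theory.
Import numFieldNormedType.Exports.
Local Open Scope group_scope.

(* A letter (t, true) stands for t and (t, false) for t^-1. *)
Section FreeGroup.
Variable T : choiceType.

Definition letter : Type := (T * bool)%type.
HB.instance Definition _ := Choice.on letter.

Definition letter_inv (x : letter) : letter := (x.1, ~~ x.2).

Definition reduced (w : seq letter) : bool :=
  sorted (fun x y => y != letter_inv x) w.

Record free_group := FreeGroup {word :> seq letter; _ : reduced word}.
HB.instance Definition _ := [isSub for word].
HB.instance Definition _ := [Choice of free_group by <:].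

Implicit Types (x y : letter) (u v w : seq letter) (s t : free_group).

Lemma word_reduced s : reduced s. Proof. exact: (valP s). Qed.

(* The reduced form of x :: w, for w reduced. *)
Definition push x w : seq letter :=
  if w is y :: w' then if y == letter_inv x then w' else x :: w else [:: x].

Definition word_mul u v : seq letter := foldr push v u.

Definition word_inv u : seq letter := rev (map letter_inv u).

Lemma letter_invK : involutive letter_inv.
Proof. by case=> t b; rewrite /letter_inv /= negbK. Qed.

Lemma push_reduced x w : reduced w -> reduced (push x w).
Proof.
case: w => [|y w] //= rw; case: ifPn => [_|yx]; first exact: path_sorted rw.
by rewrite /reduced /= yx.
Qed.

Lemma word_mul_reduced u v : reduced v -> reduced (word_mul u v).
Proof. by move=> rv; elim: u => //= x u; apply: push_reduced. Qed.

Lemma push_invK x w : reduced w -> push x (push (letter_inv x) w) = w.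
Proof.
case: w => [|y w] /= rw; first by rewrite eqxx.
rewrite letter_invK; case: eqVneq => [yx|_] /=; last by rewrite eqxx.
rewrite {}yx in rw *; case: w rw => [|z w] //= /andP[zx _].
by rewrite (negPf zx).
Qed.

Lemma word_mul_push x u w :
  reduced w -> word_mul (push x u) w = push x (word_mul u w).
Proof.
move=> rw; case: u => [|y u] //=; case: eqVneq => [->|_] //.
by rewrite push_invK // word_mul_reduced.
Qed.

Lemma word_mulA u v w :
  reduced w -> word_mul u (word_mul v w) = word_mul (word_mul u v) w.
Proof. by move=> rw; elim: u => //= x u ->; rewrite word_mul_push. Qed.

Lemma word_mul1 u : reduced u -> word_mul u [::] = u.
Proof.
elim: u => //= x u IH ru; rewrite IH; last exact: path_sorted ru.
by case: u ru {IH} => //= y u /andP[/negPf->].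
Qed.

Lemma word_invK : involutive word_inv.
Proof. by move=> u; rewrite /word_inv map_rev revK mapK //; apply: letter_invK. Qed.

Lemma word_inv_reduced u : reduced u -> reduced (word_inv u).
Proof.
rewrite /reduced rev_sorted sorted_map; apply: sub_sorted => x y /=.
by rewrite letter_invK eq_sym.
Qed.

Lemma word_mulV u : word_mul (word_inv u) u = [::].
Proof.
elim: u => //= x u IH; rewrite /word_inv map_cons rev_cons /word_mul foldr_rcons.
by rewrite /= letter_invK eqxx.
Qed.

Definition fg_one : free_group := @FreeGroup [::] isT.
Definition fg_mul s t : free_group :=
  FreeGroup (word_mul_reduced s (word_reduced t)).
Definition fg_inv s : free_group :=
  FreeGroup (word_inv_reduced (word_reduced s)).

Fact fg_mulA : associative fg_mul.
Proof. by move=> s t r; apply/val_inj/word_mulA/word_reduced. Qed.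
Fact fg_mul1g : left_id fg_one fg_mul.
Proof. by move=> s; apply/val_inj. Qed.
Fact fg_mulg1 : right_id fg_one fg_mul.
Proof. by move=> s; apply/val_inj/word_mul1/word_reduced. Qed.
Fact fg_mulVg : left_inverse fg_one fg_inv fg_mul.
Proof. by move=> s; apply/val_inj/word_mulV. Qed.
Fact fg_mulgV : right_inverse fg_one fg_inv fg_mul.
Proof. by move=> s; apply/val_inj; rewrite /= -{1}[word s]word_invK word_mulV. Qed.

HB.instance Definition _ :=
  isGroup.Build free_group fg_mulA fg_mul1g fg_mulg1 fg_mulVg fg_mulgV.

Definition fg_gen (t : T) : free_group := @FreeGroup [:: (t, true)] isT.

Definition neg_pos_changes (w : seq letter) : nat :=
  count (fun p => ~~ p.1.2 && p.2.2) (zip w (behead w)).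

End FreeGroup.

Local Open Scope classical_set_scope.
Local Open Scope ring_scope.

Definition positive_definite (C : numClosedFieldType) (G : groupType)
    (phi : G -> C) : Prop :=
  forall (m : nat) (c : 'I_m -> C) (s : 'I_m -> G),
    0 <= \sum_(i < m) \sum_(j < m) c i * (c j)^* * phi ((s j)^-1 * s i)%g.

(* A Hilbert space is a complete normed space H whose norm comes from an inner
   product dot, linear in its first argument.  The requirement that each pi s
   be onto, hence unitary, follows from the group law. *)
Section Representations.
Variables (C : numClosedFieldType) (H : completeNormedModType C).
Variable dot : {dot H for Num.conj}.

Definition norm_from_dot : Prop := forall v : H, `|v| ^+ 2 = dot v v.

Variables (G : groupType) (pi : G -> {linear H -> H}).

Definition unitary_rep : Prop :=
  [/\ forall v, pi 1%g v = v,
      forall s t v, pi (s * t)%g v = pi s (pi t v) &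
      forall s v w, dot (pi s v) (pi s w) = dot v w].

Definition orbit_span (xi : H) : set H :=
  [set v | exists (m : nat) (c : 'I_m -> C) (s : 'I_m -> G),
             v = \sum_(i < m) c i *: pi (s i) xi].

Definition cyclic_vector (xi : H) : Prop := closure (orbit_span xi) = setT.

Definition GNS_rep (phi : G -> C) (xi : H) : Prop :=
  [/\ unitary_rep, `|xi| = 1, cyclic_vector xi &
      forall s, phi s = dot (pi s xi) xi].

End Representations.

Section Eigen.
Variables (C : numClosedFieldType) (H : lmodType C) (A : H -> H).

Definition eigenspace_of (a : C) : set H := [set v | A v = a *: v].

Definition is_eigenvalue (a : C) : Prop :=
  exists2 v, v != 0 & eigenspace_of a v.

End Eigen.

Definition one_dimensional (C : numClosedFieldType) (H : lmodType C)
    (E : set H) : Prop :=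
  exists2 v, v != 0 & E = range (fun c : C => c *: v).

Definition gen_sum (C : numClosedFieldType) (H : lmodType C) (n : nat)
    (pi : free_group 'I_n -> {linear H -> H}) (v : H) : H :=
  \sum_(i < n) pi (fg_gen i) v.

Definition phi_fun (C : numClosedFieldType) (n : nat)
    (s : free_group 'I_n) : C :=
  if size s == (2 * neg_pos_changes s)%N
  then (- 1 / (n%:R - 1)) ^+ neg_pos_changes s else 0.

(* Main.v *)
Require Import Defs.
From mathcomp Require Import all_boot all_order all_algebra.
From mathcomp Require Import sesquilinear complex.
From mathcomp Require Import all_classical all_reals all_analysis.
From mathcomp Require Import ring zify.

(* Split reduced words by their first letter.  With K(s,t) = phi(t^-1 s), words
   s, t that do not start with the same letter satisfy K(s,t) = phi(s) phi(t),
   except that words s = u_j s', t = u_k t' (j != k) give b phi(s') phi(t').  So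
   after projecting off xi and the vectors u_j xi, which are the vertices of a
   regular simplex centred at 0, words with different first letters become
   orthogonal.  Peeling off first letters exhibits K as a sum of positive
   semidefinite kernels, and gives an orthogonal decomposition
     H = C xi + span(u_j xi) + sum_i N_i + sum_i R_i,
   where N_i and R_i come from the words starting with u_i^-1 and u_i.
   The operator u_i maps the orthogonal complement of xi and N_i into R_i, and
   u_i N_i is orthogonal to R_i.  If (sum_i u_i) v = a v, then comparing
   components and adding up squared norms turns the triangle and Cauchy-Schwarz
   inequalities that relate the components of v into equalities.  The resulting
   rigid relations express <v - c xi, s xi>, where c = <v, xi>, through the same
   quantity for shorter words, so v = c xi, and a c = 0. *)

Set Implicit Arguments.
Unset Strict Implicit.
Unset Printing Implicit Defensive.

Import Order.TTheory GRing.Theory Num.Theory.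
Import numFieldNormedType.Exports.
Local Open Scope classical_set_scope.
Local Open Scope ring_scope.

(** * Numerical facts *)

Lemma psum_eq0 (C : numDomainType) (I : finType) (F : I -> C) :
  (forall i, 0 <= F i) -> \sum_i F i = 0 -> forall i, F i = 0.
Proof. by move=> F0 /psumr_eq0P h i; apply: h. Qed.

Lemma padd_eq0 (C : numDomainType) (p q : C) :
  0 <= p -> 0 <= q -> p + q = 0 -> p = 0 /\ q = 0.
Proof. by move=> p0 q0 /eqP; rewrite paddr_eq0 // => /andP[/eqP -> /eqP ->]. Qed.

Lemma natr_sub1_gt0 (C : numDomainType) n : (2 <= n)%N -> 0 < n%:R - 1 :> C.
Proof. by move=> hn; rewrite subr_gt0 ltr1n. Qed.

Lemma conj_divn (C : numClosedFieldType) (a : C) n : (a / n%:R)^* = a^* / n%:R.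
Proof. by rewrite rmorphM fmorphV rmorph_nat. Qed.

Lemma conj_inv_pred (C : numClosedFieldType) n :
  ((n%:R - 1)^-1 : C)^* = (n%:R - 1)^-1.
Proof. by rewrite fmorphV rmorphB rmorph_nat rmorph1. Qed.

(* Cauchy-Schwarz, as nonnegativity of the variance. *)
Lemma sqr_norm_sum_le (C : numClosedFieldType) (I : finType) (P : pred I)
    (z : I -> C) (m : C) : 0 < m -> \sum_(i | P i) 1 <= m ->
  `|\sum_(i | P i) z i| ^+ 2 <= m * \sum_(i | P i) `|z i| ^+ 2.
Proof.
move=> m0 hm; set S := \sum_(i | P i) z i.
have mr : m^* = m by rewrite conj_Creal // gtr0_real.
have mN0 : m != 0 by rewrite gt_eqF.
have expand t : \sum_(i | P i) `|z i - t| ^+ 2 =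
    \sum_(i | P i) `|z i| ^+ 2 - S * t^* - S^* * t + (\sum_(i | P i) 1) * `|t| ^+ 2.
  rewrite /S rmorph_sum /= !mulr_suml -!sumrB -big_split /=.
  by apply: eq_bigr => i _; rewrite !normCK rmorphB /=; ring.
have : 0 <= m * \sum_(i | P i) `|z i - S / m| ^+ 2.
  by rewrite mulr_ge0 ?(ltW m0) // sumr_ge0 // => i _; rewrite exprn_ge0.
rewrite expand rmorphM fmorphV /= mr -subr_ge0 subr0 => H0.
have H1 : 0 <= (m - \sum_(i | P i) 1) * (`|S| ^+ 2 / m).
  by rewrite mulr_ge0 ?subr_ge0 // divr_ge0 ?exprn_ge0 // ltW.
rewrite -subr_ge0; move: (addr_ge0 H0 H1); congr (0 <= _).
rewrite !normCK rmorphM fmorphV /= mr; field; exact: mN0.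
Qed.

(** * The kernel on reduced words *)

(** Matches the recursion of [phi_word], which consumes two letters at a time. *)
Lemma seq_ind_pair (T : Type) (P : seq T -> Prop) :
  P [::] -> (forall x, P [:: x]) -> (forall x y w, P w -> P (x :: y :: w)) ->
  forall w, P w.
Proof.
move=> P0 P1 P2 w; suff: P w /\ forall x, P (x :: w) by case.
by elim: w => [|x w [Pw Pxw]]; split=> // y; apply: P2.
Qed.

Section Words.
Variables (T : choiceType) (C : numClosedFieldType) (b : C).
Implicit Types (x y : letter T) (u v w : seq (letter T)).

(** The condition $|s|=2\gamma(s)$ says that $s$ is a concatenation of blocks $u_i^{-1}u_j$; each
    block contributes a factor [b]. *)
Fixpoint phi_word w : C :=
  match w with
  | [::] => 1
  | [:: _] => 0
  | x :: y :: w' => if ~~ x.2 && y.2 then b * phi_word w' else 0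
  end.

Lemma phi_word_cons2 x y w :
  phi_word [:: x, y & w] = if ~~ x.2 && y.2 then b * phi_word w else 0.
Proof. by []. Qed.

Lemma phi_word_pos x w : x.2 -> phi_word (x :: w) = 0.
Proof. by case: x w => t [] // [|y w]. Qed.

Arguments phi_word : simpl never.

Lemma neg_pos_changes_pos x w :
  x.2 -> neg_pos_changes (x :: w) = neg_pos_changes w.
Proof. by case: w => [|y w] // x2; rewrite /neg_pos_changes /= x2. Qed.

Lemma neg_pos_changes_cons2 x y w :
  neg_pos_changes [:: x, y & w] = ((~~ x.2 && y.2) + neg_pos_changes (y :: w))%N.
Proof. by []. Qed.

(** Distinct sign changes occupy disjoint pairs of letters. *)
Lemma double_neg_pos_changes_le w : (2 * neg_pos_changes w <= size w)%N.
Proof.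
have [m] := ubnP (size w); elim: m w => // m IH [|x [|y w]] // lt_m.
rewrite neg_pos_changes_cons2; case: (boolP (~~ x.2 && y.2)) => [/andP[_ y2]|_].
  by rewrite neg_pos_changes_pos //; have := IH w; move: lt_m => /=; lia.
by have := IH (y :: w); move: lt_m => /=; lia.
Qed.

Lemma phi_wordE w :
  (if size w == (2 * neg_pos_changes w)%N then b ^+ neg_pos_changes w else 0)
  = phi_word w.
Proof.
elim/seq_ind_pair: w => [|x|x y w IH] //.
rewrite phi_word_cons2 neg_pos_changes_cons2 /=; case: (boolP (~~ x.2 && y.2)) => [/andP[_ y2]|_].
  rewrite neg_pos_changes_pos // -IH add1n mulnS !eqSS.
  by case: ifP => _; rewrite ?mulr0 // exprS.
(* The first letter belongs to no sign change, so the bound for [y :: w] makes equality of lengths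
   impossible. *)
rewrite ifF //; apply/negbTE.
by have /= := double_neg_pos_changes_le (y :: w); rewrite add0n; lia.
Qed.

(** A negative letter never closes a block, so no block straddles the cut. *)
Lemma phi_word_cat u v : (if v is y :: _ then ~~ y.2 else true) ->
  phi_word (u ++ v) = phi_word u * phi_word v.
Proof.
move=> hv; elim/seq_ind_pair: u => [|x|x y u IH]; first by rewrite mul1r.
  case: v hv => [|y v] hv; first by rewrite mulr1.
  by rewrite /= phi_word_cons2 (negPf hv) andbF mul0r.
by rewrite /= !phi_word_cons2; case: ifP => _; rewrite ?mul0r // IH mulrA.
Qed.

(** In a concatenation of blocks two positive letters are never adjacent. *)
Lemma phi_word_cat_pos u x v y : x.2 -> y.2 -> phi_word (rcons u x ++ y :: v) = 0.
Proof.
move=> x2 y2; elim/seq_ind_pair: u => [|z|z t u IH] /=.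
- by rewrite phi_word_pos.
- by rewrite phi_word_cons2 x2; case: ifP => _ //; rewrite phi_word_pos ?mulr0.
- by rewrite phi_word_cons2; case: ifP => _ //; rewrite IH mulr0.
Qed.

Lemma word_inv_cons x w : word_inv (x :: w) = rcons (word_inv w) (letter_inv x).
Proof. by rewrite /word_inv map_cons rev_cons. Qed.

(** Inversion reverses the order of the blocks and turns $u_i^{-1}u_j$ into $u_j^{-1}u_i$, again a
    block. *)
Lemma phi_word_inv w : phi_word (word_inv w) = phi_word w.
Proof.
elim/seq_ind_pair: w => [|x|x y w IH] //.
rewrite !word_inv_cons phi_word_cons2 -!cats1 -catA /=.
case: (boolP x.2) => x2 /=; last case: (boolP y.2) => y2 /=.
- by rewrite -cat_rcons phi_word_cat /= ?x2 // mulr0.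
- by rewrite phi_word_cat /= ?y2 // phi_word_cons2 /= x2 y2 IH mulr1 mulrC.
- by rewrite -cat_rcons phi_word_cat_pos.
Qed.

Definition phi_ker u v : C := phi_word (word_mul (word_inv v) u).

Lemma phi_ker_cons x u v : phi_ker (x :: u) (x :: v) = phi_ker u v.
Proof.
by rewrite /phi_ker word_inv_cons /word_mul foldr_rcons /= letter_invK eqxx.
Qed.

Lemma word_mul_cat u v : reduced (u ++ v) -> word_mul u v = u ++ v.
Proof.
elim: u => //= x u IH; move=> ruv; rewrite IH; last exact: path_sorted ruv.
by case: (u ++ v) ruv => // y w /= /andP[/negbTE ->].
Qed.

Definition same_head u v :=
  match u, v with x :: _, y :: _ => x == y | _, _ => false end.

(** Different first letters leave nothing to cancel at the junction of $v^{-1}$ and $u$. *)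
Lemma phi_ker_cat u v : reduced u -> reduced v -> ~~ same_head u v ->
  phi_ker u v = phi_word (word_inv v ++ u).
Proof.
move=> ru rv; case: v rv => [|y v] rv hd; first by rewrite /phi_ker.
case: u ru hd => [|x u] ru hd.
  by rewrite /phi_ker word_mul1 ?cats0 //; apply: word_inv_reduced.
rewrite /phi_ker word_mul_cat //; have := word_inv_reduced rv.
rewrite word_inv_cons cat_rcons /reduced sorted_cat_cons => -> /=.
by rewrite letter_invK [path _ _ _]ru andbT.
Qed.

Definition pos_tail x w : C :=
  if w is y :: w' then if x == y then phi_word w' else 0 else 0.

(* The value at (u, v) of the kernel obtained by projecting words onto the span
   of the generators u_j xi; [pos_tail] gives the coefficients of this projection. *)
Definition gen_ker u v : C :=
  match u, v with
  | x :: u', y :: v' =>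
    if x.2 && y.2 then (if x == y then 1 else b) * (phi_word u' * phi_word v') else 0
  | _, _ => 0
  end.

(** Everything depends on the junction of $v^{-1}u$: it is a clean cut when [u] starts with a
    negative letter, kills the value when it joins two positive letters, and forms one extra block,
    hence the factor [b], when both words start with positive letters. *)
Lemma phi_ker_diff u v : reduced u -> reduced v -> ~~ same_head u v ->
  phi_ker u v = phi_word u * phi_word v + gen_ker u v.
Proof.
move=> ru rv hd; rewrite phi_ker_cat //.
case: u ru hd => [|x u] ru hd; first by rewrite cats0 phi_word_inv mul1r addr0.
case: v rv hd => [|y v] rv /= hd; first by rewrite mulr1 addr0.
rewrite (negPf hd) word_inv_cons; case: (boolP x.2) => x2 /=; last first.
  by rewrite phi_word_cat ?x2 // -word_inv_cons phi_word_inv addr0 mulrC.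
rewrite phi_word_pos // mul0r add0r.
case: (boolP y.2) => y2; last by rewrite phi_word_cat_pos.
by rewrite cat_rcons phi_word_cat /= ?y2 // phi_word_cons2 /= x2 y2 phi_word_inv mulrCA [phi_word v * _]mulrC.
Qed.

End Words.

(** * Positive semidefiniteness of the kernel *)

Section Kernel.
Variables (C : numClosedFieldType) (n : nat).
Hypothesis hn : (2 <= n)%N.
Let b : C := - 1 / (n%:R - 1).
Local Notation word := (seq (letter 'I_n)).
Implicit Types (u v w : word) (x : letter 'I_n).
Local Notation phi_word := (phi_word b).
Local Notation gen_ker := (@gen_ker _ C b).
Local Notation phi_ker := (phi_ker b).
Local Notation pos_tail := (@pos_tail _ C b).

(* The kernel left after projecting off xi and the generators u_j xi. *)
Definition res_ker u v : C := phi_ker u v - phi_word u * phi_word v - gen_ker u v.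

Lemma res_ker_diff u v : reduced u -> reduced v -> ~~ same_head u v -> res_ker u v = 0.
Proof. by move=> ru rv hd; rewrite /res_ker phi_ker_diff //; ring. Qed.

(** Stripping a common $u_i$ removes the rank-one term, since [phi_word] vanishes on words with a
    positive first letter; the diagonal of [gen_ker] supplies [phi_word u * phi_word v]. *)
Lemma res_ker_pos i u v :
  res_ker ((i, true) :: u) ((i, true) :: v) = res_ker u v + gen_ker u v.
Proof.
rewrite /res_ker phi_ker_cons !phi_word_pos //= eqxx; ring.
Qed.

Lemma res_ker_neg i u v (x := (i, false) : letter 'I_n) :
  res_ker (x :: u) (x :: v) =
  res_ker u v + phi_word u * phi_word v + (gen_ker u v - phi_word (x :: u) * phi_word (x :: v)).
Proof. by rewrite /res_ker phi_ker_cons /=; ring. Qed.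

Lemma conj_b : b^* = b.
Proof. by rewrite /b rmorphM fmorphV rmorphB rmorphN rmorph1 rmorph_nat. Qed.

Lemma conj_phi_word w : (phi_word w)^* = phi_word w.
Proof.
elim/seq_ind_pair: w => [|x|x y w IH]; rewrite ?rmorph1 ?rmorph0 //.
by rewrite phi_word_cons2; case: ifP => _; rewrite ?rmorph0 // rmorphM /= IH conj_b.
Qed.

Lemma conj_pos_tail x w : (pos_tail x w)^* = pos_tail x w.
Proof. by case: w => [|y w] /=; rewrite ?rmorph0 //; case: ifP; rewrite ?rmorph0 ?conj_phi_word. Qed.

(** The matrix with 1 on the diagonal and [b] elsewhere is the Gram matrix of the vectors
    $u_j\xi$. *)
Lemma gen_kerE u v :
  gen_ker u v = \sum_(j < n) \sum_(k < n)
     (if j == k then 1 else b) * (pos_tail (j, true) u * pos_tail (k, true) v).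
Proof.
case: u => [|[i e] u] /=.
  by rewrite big1 // => j _; rewrite big1 // => k _; rewrite mul0r mulr0.
case: v => [|[k f] v] /=.
  by rewrite big1 // => j _; rewrite big1 // => k _; rewrite !mulr0.
rewrite (bigD1 i) //= (bigD1 k) //= !xpair_eqE !eqxx /= big1 ?addr0; last first.
  by move=> l /negbTE lk; rewrite !xpair_eqE lk !mulr0.
rewrite big1 ?addr0; last first.
  move=> l /negbTE li; rewrite big1 // => l' _.
  by rewrite !xpair_eqE li mul0r mulr0.
by case: e; case: f; rewrite /= ?andbT ?andbF ?mulr0 ?mul0r ?mulr0.
Qed.

Lemma phi_word_neg i w :
  phi_word ((i, false) :: w) = b * \sum_(j < n) pos_tail (j, true) w.
Proof.
case: w => [|[j e] w]; first by rewrite big1 ?mulr0.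
rewrite phi_word_cons2 /=; case: e => /=; last first.
  by rewrite big1 ?mulr0 // => k _; rewrite !xpair_eqE andbF.
rewrite (bigD1 j) //= eqxx big1 ?addr0 // => k /negbTE kj.
by rewrite !xpair_eqE kj.
Qed.

Lemma sum_rank1 (I : finType) (c f : I -> C) : (forall i, (f i)^* = f i) ->
  \sum_i \sum_j c i * (c j)^* * (f i * f j) = `|\sum_i c i * f i| ^+ 2.
Proof.
move=> fr; rewrite normCK rmorph_sum mulr_suml; apply: eq_bigr => i _.
rewrite mulr_sumr; apply: eq_bigr => j _; rewrite rmorphM /= fr; ring.
Qed.

Let n1_gt0 : 0 < n%:R - 1 :> C.
Proof. exact: natr_sub1_gt0. Qed.

Let n_gt0 : 0 < n%:R :> C.
Proof. by rewrite ltr0n; lia. Qed.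

(** The Gram matrix is $(1-b)I+bJ$ with $J$ the all-ones matrix, and $1-b=n/(n-1)$. *)
Lemma gen_ker_form (I : finType) (c : I -> C) (s : I -> word)
    (z := fun j => \sum_i c i * pos_tail (j, true) (s i)) :
  \sum_i \sum_j c i * (c j)^* * gen_ker (s i) (s j) =
  (n%:R * \sum_j `|z j| ^+ 2 - `|\sum_j z j| ^+ 2) / (n%:R - 1).
Proof.
have bE : b = - 1 / (n%:R - 1) by [].
have wE u v : gen_ker u v = b * ((\sum_j pos_tail (j, true) u) * (\sum_j pos_tail (j, true) v))
   + (1 - b) * \sum_j pos_tail (j, true) u * pos_tail (j, true) v.
  rewrite gen_kerE mulr_suml !mulr_sumr -big_split /=; apply: eq_bigr => j _.
  rewrite (bigD1 j) //= eqxx [in RHS](bigD1 j) //=.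
  under eq_bigr => k kj do rewrite eq_sym (negPf kj) mulrA.
  by rewrite -mulr_sumr; ring.
have conjS w : (\sum_j pos_tail (j, true) w)^* = \sum_j pos_tail (j, true) w.
  by rewrite rmorph_sum /=; apply: eq_bigr => j _; rewrite conj_pos_tail.
transitivity (b * `|\sum_j z j| ^+ 2 + (1 - b) * \sum_j `|z j| ^+ 2); last first.
  by rewrite bE; field; rewrite gt_eqF.
under eq_bigr => i _ do under eq_bigr => j _ do
  rewrite wE mulrDr mulrCA [X in _ + X]mulrCA.
under eq_bigr => i _ do rewrite big_split -!mulr_sumr /=.
rewrite big_split -!mulr_sumr /= sum_rank1; last by move=> i; apply: conjS.
congr (_ * `|_| ^+ 2 + _ * _).
  by rewrite exchange_big /=; apply: eq_bigr => i _; rewrite mulr_sumr.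
under eq_bigr => i _ do under eq_bigr => j _ do rewrite mulr_sumr.
under eq_bigr => i _ do rewrite exchange_big.
rewrite exchange_big /=; apply: eq_bigr => k _.
by rewrite sum_rank1 // => i; apply: conj_pos_tail.
Qed.

Lemma gen_ker_form_ge0 (I : finType) (c : I -> C) (s : I -> word) :
  0 <= \sum_i \sum_j c i * (c j)^* * gen_ker (s i) (s j).
Proof.
rewrite gen_ker_form divr_ge0 ?(ltW n1_gt0) // subr_ge0.
by apply: sqr_norm_sum_le; rewrite // sumr_const card_ord.
Qed.

(** The hypothesis makes [z k] vanish, so Cauchy-Schwarz applies to only $n-1$ terms; this gain is
    exactly what pays for the subtracted square in [res_ker_neg]. *)
Lemma gen_ker_form_neg_ge0 (I : finType) (c : I -> C) (s : I -> word) (k : 'I_n) :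
  (forall i, c i * pos_tail (k, true) (s i) = 0) ->
  `|\sum_i c i * phi_word ((k, false) :: s i)| ^+ 2 <=
  \sum_i \sum_j c i * (c j)^* * gen_ker (s i) (s j).
Proof.
move=> h; rewrite gen_ker_form.
set z := fun j => \sum_i c i * pos_tail (j, true) (s i).
have zk : z k = 0 by rewrite /z big1.
have -> : \sum_i c i * phi_word ((k, false) :: s i) = b * \sum_j z j.
  under eq_bigr => i _ do rewrite phi_word_neg mulrCA mulr_sumr.
  by rewrite -mulr_sumr exchange_big.
have le_z : `|\sum_j z j| ^+ 2 <= (n%:R - 1) * \sum_j `|z j| ^+ 2.
  rewrite (bigD1 k) //= [in leRHS](bigD1 k) //= zk normr0 expr0n !add0r.
  apply: sqr_norm_sum_le => //.
  rewrite (eq_bigl [in predC1 k]) // sumr_const cardC1 card_ord.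
  by rewrite -subn1 natrB //; lia.
rewrite -subr_ge0; have : 0 <= n%:R / (n%:R - 1) ^+ 2 *
    ((n%:R - 1) * (\sum_j `|z j| ^+ 2) - `|\sum_j z j| ^+ 2).
  by rewrite mulr_ge0 ?subr_ge0 // divr_ge0 ?exprn_ge0 // ltW.
congr (0 <= _); rewrite normrM exprMn [`|b| ^+ 2]normCK conj_b.
have bE : b = - 1 / (n%:R - 1) by [].
by rewrite bE; field; rewrite gt_eqF.
Qed.

(** Induction on the maximal word length: words with different first letters decouple, and within
    one first letter the form for the tails reappears with nonnegative corrections. *)
Lemma res_ker_form_ge0 (I : finType) (c : I -> C) (s : I -> word) :
  (forall i, reduced (s i)) ->
  0 <= \sum_i \sum_j c i * (c j)^* * res_ker (s i) (s j).
Proof.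
have : exists m, forall i, (size (s i) <= m)%N.
  by exists (\max_i size (s i)) => i; apply: leq_bigmax.
case=> m; elim: m c s => [|m IH] c s sm rs.
  rewrite big1 // => i _; rewrite big1 // => j _.
  rewrite res_ker_diff ?mulr0 //; have := sm i.
  by rewrite leqn0 size_eq0 => /eqP ->.
(* The coefficients restricted to words starting with [x]; setting the others to 0 keeps the index
   type fixed. *)
pose cx x i := if s i is y :: _ then if y == x then c i else 0 else 0.
have IHx x : 0 <= \sum_i \sum_j cx x i * (cx x j)^* *
    res_ker (behead (s i)) (behead (s j)).
  apply: IH => i; first by rewrite size_behead; have := sm i; lia.
  by have := rs i; case: (s i) => //= y w; apply: path_sorted.
have -> : \sum_i \sum_j c i * (c j)^* * res_ker (s i) (s j) =
  \sum_x \sum_i \sum_j cx x i * (cx x j)^* *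
    res_ker (x :: behead (s i)) (x :: behead (s j)).
  rewrite [RHS]exchange_big; apply: eq_bigr => i _ /=.
  rewrite [RHS]exchange_big; apply: eq_bigr => j _ /=.
  have [|dh] := boolP (same_head (s i) (s j)); last first.
    rewrite res_ker_diff // mulr0 big1 // => x _; rewrite /cx.
    move: dh; case: (s i) => [|y w]; first by rewrite !mul0r.
    case: (s j) => [|y' w'] /= dh; first by rewrite rmorph0 mulr0 mul0r.
    have [yx|_] := eqVneq y x; last by rewrite !mul0r.
    by rewrite -yx eq_sym (negPf dh) rmorph0 mulr0 mul0r.
  rewrite /cx; case: (s i) => // y w; case: (s j) => // y' w' /= /eqP <-.
  rewrite (bigD1 y) //= eqxx big1 ?addr0 // => x /negbTE xy.
  by rewrite eq_sym xy !mul0r.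
apply: sumr_ge0 => -[k []] _.
  under eq_bigr => i _ do under eq_bigr => j _ do rewrite res_ker_pos mulrDr.
  under eq_bigr => i _ do rewrite big_split /=.
  by rewrite big_split addr_ge0 ?gen_ker_form_ge0.
under eq_bigr => i _ do under eq_bigr => j _ do rewrite res_ker_neg mulrDr mulrBr mulrDr.
under eq_bigr => i _ do rewrite big_split sumrB big_split /=.
rewrite big_split sumrB big_split /= addr_ge0 //.
  by rewrite addr_ge0 // sum_rank1 ?exprn_ge0 // => i; apply: conj_phi_word.
rewrite subr_ge0 (sum_rank1 (cx (k, false)) (f := fun i => phi_word ((k, false) :: behead (s i)))).
  (* A reduced word starting with $u_k^{-1}$ cannot continue with $u_k$. *)
  apply: gen_ker_form_neg_ge0 => i; rewrite /cx; have := rs i.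
  case: (s i) => [|y w] rw; first by rewrite mul0r.
  case: eqVneq => [yk|_]; last by rewrite mul0r.
  case: w rw => [|z w] /=; first by rewrite mulr0.
  by rewrite yk => /andP[/negbTE]; rewrite eq_sym => ->; rewrite mulr0.
by move=> i; apply: conj_phi_word.
Qed.

Lemma phi_ker_form_ge0 (I : finType) (c : I -> C) (s : I -> word) :
  (forall i, reduced (s i)) ->
  0 <= \sum_i \sum_j c i * (c j)^* * phi_ker (s i) (s j).
Proof.
move=> rs.
have wE u v : phi_ker u v = res_ker u v + phi_word u * phi_word v + gen_ker u v.
  by rewrite /res_ker; ring.
under eq_bigr => i _ do under eq_bigr => j _ do rewrite wE mulrDr mulrDr.
under eq_bigr => i _ do rewrite !big_split /=.
rewrite !big_split /= !addr_ge0 ?gen_ker_form_ge0 ?res_ker_form_ge0 //.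
by rewrite sum_rank1 ?exprn_ge0 // => i; apply: conj_phi_word.
Qed.

Lemma phi_funE (s : free_group 'I_n) : phi_fun C s = phi_word s.
Proof. by rewrite -phi_wordE. Qed.

Lemma phi_fun_pd : positive_definite (@phi_fun C n).
Proof.
move=> m c s.
under eq_bigr => i _ do under eq_bigr => j _ do
  rewrite phi_funE -[Defs.word _]/(word_mul (word_inv (s j)) (s i)) -/(phi_ker _ _).
by apply: phi_ker_form_ge0 => i; apply: word_reduced.
Qed.

End Kernel.

(** * Orthogonal projections *)

Section DotTheory.
Variables (C : numClosedFieldType) (H : lmodType C) (dot : {dot H for Num.conj}).
Implicit Types (u v w : H) (a : C) (D : set H).

Lemma dotC u v : dot u v = (dot v u)^*.
Proof. by rewrite [LHS]hermC mul1r. Qed.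

Lemma dot0l v : dot 0 v = 0. Proof. exact: linear0l. Qed.
Lemma dot0r v : dot v 0 = 0. Proof. exact: linear0r. Qed.
Lemma dotDl u v w : dot (u + v) w = dot u w + dot v w. Proof. exact: linearDl. Qed.
Lemma dotDr u v w : dot u (v + w) = dot u v + dot u w. Proof. exact: linearDr. Qed.
Lemma dotBl u v w : dot (u - v) w = dot u w - dot v w. Proof. exact: linearBl. Qed.
Lemma dotBr u v w : dot u (v - w) = dot u v - dot u w. Proof. exact: linearBr. Qed.
Lemma dotZl a u v : dot (a *: u) v = a * dot u v. Proof. exact: linearZl_LR. Qed.
Lemma dotZr a u v : dot u (a *: v) = a^* * dot u v. Proof. exact: linearZr_LR. Qed.
Lemma dot_suml I r (P : pred I) (F : I -> H) v :
  dot (\sum_(i <- r | P i) F i) v = \sum_(i <- r | P i) dot (F i) v.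
Proof. exact: linear_sumlz. Qed.
Lemma dot_sumr I r (P : pred I) (F : I -> H) v :
  dot v (\sum_(i <- r | P i) F i) = \sum_(i <- r | P i) dot v (F i).
Proof. exact: linear_sumr. Qed.

Definition dotE := (dotBl, dotBr, dotDl, dotDr, dotZl, dotZr).

Lemma dot_ge0 u : 0 <= dot u u. Proof. exact: dnorm_ge0. Qed.

Lemma dot_eq0 u : dot u u = 0 -> u = 0.
Proof. by move/eqP; rewrite dnorm_eq0 => /eqP. Qed.

Lemma dot_eq0C u v : dot u v = 0 -> dot v u = 0.
Proof. by rewrite dotC => /eqP; rewrite fmorph_eq0 => /eqP. Qed.

(** Test the hypothesis at the optimal coefficient [dot u v / dot v v]. The choice [e = dot u u]
    gives Cauchy-Schwarz; small [e] serves near-minimizers of a distance. *)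
Lemma near_orthogonal u v e : (forall a, dot u u <= dot (u - a *: v) (u - a *: v) + e) ->
  `|dot u v| ^+ 2 <= e * dot v v.
Proof.
have [-> _|v0 hu] := eqVneq v 0; first by rewrite !dot0r normr0 expr0n mulr0.
have vv0 : dot v v != 0 by rewrite dnorm_eq0.
have vvr : (dot v v)^* = dot v v by rewrite -dotC.
rewrite -ler_pdivrMr ?dnorm_gt0 //; have := hu (dot u v / dot v v).
rewrite -subr_ge0 => h; rewrite -subr_ge0; move: h; congr (0 <= _).
rewrite !dotE [dot v u]dotC rmorphM fmorphV /= vvr normCK; field; exact: vv0.
Qed.

Lemma cauchy_schwarz u v : `|dot u v| ^+ 2 <= dot u u * dot v v.
Proof.
by apply: near_orthogonal => a; rewrite lerDr dot_ge0.
Qed.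

Definition orthogonal_to D : set H := [set y | forall z, D z -> dot z y = 0].
(** In a Hilbert space this is the closed linear span of [D], described through the inner product
    alone. *)
Definition bipolar D : set H := [set x | forall y, orthogonal_to D y -> dot x y = 0].

Lemma sub_bipolar D : D `<=` bipolar D.
Proof. by move=> z Dz y; apply. Qed.

Lemma bipolar0 D : bipolar D 0. Proof. by move=> y _; apply: dot0l. Qed.

Lemma bipolarD D u v : bipolar D u -> bipolar D v -> bipolar D (u + v).
Proof. by move=> hu hv y Dy; rewrite dotDl hu ?hv ?addr0. Qed.

Lemma bipolarZ D a u : bipolar D u -> bipolar D (a *: u).
Proof. by move=> hu y Dy; rewrite dotZl hu ?mulr0. Qed.

Lemma bipolarB D u v : bipolar D u -> bipolar D v -> bipolar D (u - v).
Proof. by move=> hu hv; rewrite -scaleN1r; apply/bipolarD/bipolarZ. Qed.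

Lemma bipolar_sum D (I : finType) (P : pred I) (F : I -> H) :
  (forall i, P i -> bipolar D (F i)) -> bipolar D (\sum_(i | P i) F i).
Proof. by move=> h; elim/big_ind: _ => //; [apply: bipolar0|apply: bipolarD]. Qed.

Lemma bipolar_orthogonal D1 D2 u v : (forall x y, D1 x -> D2 y -> dot x y = 0) ->
  bipolar D1 u -> bipolar D2 v -> dot u v = 0.
Proof.
move=> h hu hv; apply: hu => x D1x; apply: dot_eq0C; apply: hv => y D2y.
by apply/dot_eq0C/h.
Qed.

End DotTheory.

(** * Existence of projections in a Hilbert space *)

Section Projection.
Variables (R : realType) (H : completeNormedModType R[i]).
Variable dot : {dot H for Num.conj}.
Hypothesis dotN : norm_from_dot dot.
Local Notation C := R[i].
Implicit Types (u v w : H) (a e : C) (D : set H).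

Lemma invS_lt e : 0 < e -> exists N : nat, (N.+1%:R^-1 : C) < e.
Proof.
move=> e0; have er : e = (complex.Re e)%:C%C by rewrite RRe_real // gtr0_real.
have re0 : 0 < complex.Re e by rewrite er ltcR in e0.
have [N _ hN] := near_infty_natSinv_lt (PosNum re0).
exists N; rewrite er.
have -> : (N.+1%:R^-1 : C) = (N.+1%:R^-1)%:C%C by rewrite fmorphV rmorph_nat.
by rewrite ltcR; apply: hN => /=.
Qed.

(** The order on [R[i]] is partial, so the infimum is taken over real parts; squared norms and
    positive [e] are real. *)
Lemma near_minimizer D v e : 0 < e -> exists2 x, bipolar dot D x &
  forall y, bipolar dot D y -> dot (v - x) (v - x) <= dot (v - y) (v - y) + e.
Proof.
move=> e0; have er : e = (complex.Re e)%:C%C by rewrite RRe_real // gtr0_real.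
have re0 : 0 < complex.Re e by rewrite er ltcR in e0.
pose E := [set complex.Re (dot (v - x) (v - x)) | x in bipolar dot D].
have qr u : dot u u = (complex.Re (dot u u))%:C%C by rewrite RRe_real // ger0_real ?dot_ge0.
have lbE : has_lbound E.
  by exists 0 => _ [x _ <-]; rewrite -lecR -qr dot_ge0.
have infE : has_inf E by split => //; exists (complex.Re (dot (v - 0) (v - 0))); exists 0 => //; apply: bipolar0.
have [_ [x Dx <-] hx] := inf_adherent re0 infE.
exists x => // y Dy; rewrite qr [in leRHS]qr er -rmorphD lecR.
by rewrite (le_trans (ltW hx)) // lerD2r; apply: ge_inf => //; exists y.
Qed.

(** A minimizing sequence has residuals almost orthogonal to [bipolar dot D]; this makes the
    sequence Cauchy, and its limit is the projection. *)
Lemma projection_exists D v :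
  exists2 p, bipolar dot D p & orthogonal_to dot D (v - p).
Proof.
have /choice[x hx] : forall m : nat, exists x, bipolar dot D x /\
    forall y, bipolar dot D y ->
      dot (v - x) (v - x) <= dot (v - y) (v - y) + m.+1%:R^-1.
  move=> m; have m0 : (0 : C) < m.+1%:R^-1 by rewrite invr_gt0 ltr0n.
  by have [x Dx hx] := near_minimizer D v m0; exists x.
have Dx m : bipolar dot D (x m) by have [] := hx m.
have orth m y : bipolar dot D y -> `|dot (v - x m) y| ^+ 2 <= m.+1%:R^-1 * dot y y.
  move=> Dy; apply: near_orthogonal => a; rewrite -addrA -opprD.
  by have [_] := hx m; apply; apply/bipolarD/bipolarZ.
have sqrD (a c : C) : `|a - c| ^+ 2 <= 2 * (`|a| ^+ 2 + `|c| ^+ 2).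
  rewrite -subr_ge0; have := exprn_ge0 2 (normr_ge0 (a + c)); congr (0 <= _).
  rewrite !normCK !rmorphB !rmorphD; ring.
have dist m k : `|x m - x k| ^+ 2 <= 2 * (m.+1%:R^-1 + k.+1%:R^-1).
  rewrite dotN; set y := x m - x k; have Dy : bipolar dot D y by apply: bipolarB.
  have [->|y0] := eqVneq (dot y y) 0; first by rewrite mulr_ge0 ?addr_ge0 ?invr_ge0.
  have yy0 : 0 < dot y y by rewrite lt_def y0 dot_ge0.
  (* The squared distance is a difference of two almost vanishing inner products, both bounded by
     [orth]. *)
  have yE : dot y y = dot (v - x k) y - dot (v - x m) y.
    by rewrite -dotBl; congr (dot _ _); rewrite opprB addrC addrA subrK.
  rewrite -(ler_pM2r yy0) -expr2 -[X in X ^+ 2]ger0_norm ?dot_ge0 // [X in `|X|]yE.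
  rewrite (le_trans (sqrD _ _)) // -mulrA ler_pM2l // mulrDl [leRHS]addrC.
  by rewrite lerD // orth.
have small e : 0 < e -> exists N, forall m, (N <= m)%N -> m.+1%:R^-1 < e.
  move=> /invS_lt[N hN]; exists N => m Nm; apply: le_lt_trans hN.
  by rewrite lef_pV2 ?posrE ?ltr0n // ler_nat.
have /cvg_ex[/= p xp] : cvg (x @ \oo).
  apply: cauchy_cvg; apply: cauchy_exP => e e0.
  have [|N hN] := small (e ^+ 2 / 4); first by rewrite divr_gt0 // exprn_gt0.
  exists (x N); exists N => // m /= Nm; rewrite -ball_normE /=.
  rewrite -(ltr_pXn2r (ltn0Sn 1)) ?nnegrE ?normr_ge0 ?(ltW e0) //.
  rewrite (le_lt_trans (dist _ _)) //.
  rewrite -[ltRHS](_ : 2 * (e ^+ 2 / 4 + e ^+ 2 / 4) = _); last by field.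
  by rewrite ltr_pM2l // ltrD ?hN.
have approx (t y : H) : (forall m, `|dot t y| ^+ 2 <=
    2 * dot y y * (m.+1%:R^-1 + `|p - x m| ^+ 2)) -> dot t y = 0.
  move=> h; apply/eqP; rewrite -normr_eq0 -sqrf_eq0; apply/negP => /negP t0.
  have tgt0 : 0 < `|dot t y| ^+ 2 by rewrite lt_def t0 exprn_ge0.
  (* The summand 1 keeps [M] positive even when [y] is 0. *)
  pose M := 2 * dot y y + 1; have M0 : 0 < M by rewrite ltr_wpDl ?mulr_ge0 ?dot_ge0.
  pose e := `|dot t y| ^+ 2 / M / 2.
  have e0 : 0 < e by rewrite !divr_gt0.
  have [N1 hN1] := small e e0.
  have : 0 < sqrtC e by rewrite sqrtC_gt0.
  move/cvgrPdist_lt : xp => /[apply] -[N2 _ hN2].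
  have := h (N1 + N2)%N; apply/negP; rewrite -real_ltNge ?realE ?exprn_ge0 //; last first.
    by rewrite !mulr_ge0 ?dot_ge0 // addr_ge0 ?invr_ge0 ?exprn_ge0.
  have lt2 : (N1 + N2).+1%:R^-1 + `|p - x (N1 + N2)%N| ^+ 2 < e + e.
    rewrite ltrD ?hN1 ?leq_addr // -[ltRHS]sqrtCK ltr_pXn2r ?nnegrE ?sqrtC_ge0 ?(ltW e0) //.
    by apply: hN2 => /=; apply: leq_addl.
  have -> : `|dot t y| ^+ 2 = M * (e + e) by rewrite /e; field; rewrite gt_eqF.
  apply: le_lt_trans (_ : M * ((N1 + N2).+1%:R^-1 + `|p - x (N1 + N2)%N| ^+ 2) < _); last first.
    by rewrite ltr_pM2l.
  by rewrite ler_wpM2r ?lerDl // addr_ge0 ?invr_ge0 ?exprn_ge0.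
have csx m y : `|dot (p - x m) y| ^+ 2 <= dot y y * `|p - x m| ^+ 2.
  by rewrite dotN mulrC cauchy_schwarz.
exists p.
  move=> y Dy; apply: approx => m.
  have -> : dot p y = dot (p - x m) y by rewrite dotBl (Dx m y Dy) subr0.
  rewrite (le_trans (csx _ _)) // -mulrA -subr_ge0.
  have -> : 2 * (dot y y * (m.+1%:R^-1 + `|p - x m| ^+ 2)) - dot y y * `|p - x m| ^+ 2 =
    dot y y * (2 * m.+1%:R^-1 + `|p - x m| ^+ 2) by ring.
  by rewrite mulr_ge0 ?dot_ge0 // addr_ge0 ?mulr_ge0 ?invr_ge0 ?exprn_ge0.
move=> z Dz; apply: dot_eq0C; apply: approx => m.
have -> : dot (v - p) z = dot (v - x m) z - dot (p - x m) z.
  by rewrite -dotBl opprB addrA subrK.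
rewrite (le_trans (sqrD _ _)) // -mulrA ler_pM2l // mulrDr lerD //.
by rewrite mulrC orth //; apply: sub_bipolar.
Qed.

(** If [v] were nonzero, some [w] in [S] would be closer to [v] than [|v|]; but
    [dot v (v - w) = dot v v], so Cauchy-Schwarz gives [|v| <= |v - w|]. *)
Lemma dense_orthogonal_eq0 (S : set H) v :
  closure S = setT -> (forall x, S x -> dot v x = 0) -> v = 0.
Proof.
move=> clS hv; apply/eqP/negP => /negP v0.
have vv0 : 0 < dot v v by rewrite lt_def dot_ge0 andbT dnorm_eq0.
have nv0 : 0 < `|v| by rewrite normr_gt0.
have : closure S v by rewrite clS.
move=> /(_ _ (nbhsx_ballx v _ nv0))[w [Sw]].
rewrite -ball_normE /= => vw.
have := cauchy_schwarz dot v (v - w); rewrite dotBr (hv _ Sw) subr0.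
rewrite ger0_norm ?dot_ge0 // expr2 ler_pM2l // -!dotN.
by rewrite ler_pXn2r ?nnegrE // lt_geF.
Qed.

End Projection.

(** * The cyclic representation *)

Section Decomposition.
Variables (R : realType) (n : nat).
Hypothesis hn : (2 <= n)%N.
Local Notation C := R[i].
Variables (H : completeNormedModType C) (dot : {dot H for Num.conj}).
Variables (pi : free_group 'I_n -> {linear H -> H}) (xi : H).
Hypothesis dotN : norm_from_dot dot.
Hypothesis gns : GNS_rep dot pi (@phi_fun C n) xi.
Let b : C := - 1 / (n%:R - 1).
Local Notation word := (seq (letter 'I_n)).
Implicit Types (s t : word) (x y : letter 'I_n) (u v w z : H).
Local Notation phi_word := (phi_word b).
Local Notation gen_ker := (@gen_ker _ C b).
Local Notation phi_ker := (phi_ker b).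
Local Notation bip D := (bipolar dot D).
Local Notation pos i := ((i, true) : letter 'I_n).
Local Notation neg i := ((i, false) : letter 'I_n).

Definition act x : {linear H -> H} := pi (@FreeGroup _ [:: x] isT).

Definition word_vec s : H := foldr (fun x => act x) xi s.

Arguments word_vec : simpl never.

Lemma word_vec_cons x s : word_vec (x :: s) = act x (word_vec s). Proof. by []. Qed.

Lemma act_isometry x u v : dot (act x u) (act x v) = dot u v.
Proof. by case: gns => -[_ _ iso] _ _ _; apply: iso. Qed.

Lemma act_invK x v : act x (act (letter_inv x) v) = v.
Proof.
case: gns => -[pi1 piM _] _ _ _; rewrite /act -piM -[RHS]pi1.
by congr (pi _ v); apply/val_inj; rewrite /= eqxx.
Qed.

Lemma act_adjoint x u v : dot (act x u) v = dot u (act (letter_inv x) v).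
Proof. by rewrite -[v in LHS](act_invK x) act_isometry. Qed.

Lemma pi_xi (g : free_group 'I_n) : pi g xi = word_vec (Defs.word g).
Proof.
case: gns => -[pi1 piM _] _ _ _; case: g => s /=.
elim: s => [|x s IH] rs; first by rewrite -[RHS]pi1; congr (pi _ xi); apply/val_inj.
have rs' : reduced s by apply: path_sorted rs.
rewrite word_vec_cons -(IH rs') /act -piM; congr (pi _ xi); apply/val_inj => /=.
by case: s rs {IH rs'} => //= y s /andP[/negbTE ->].
Qed.

Lemma dot_word_vec s t : reduced s -> reduced t -> dot (word_vec s) (word_vec t) = phi_ker s t.
Proof.
move=> rs rt; case: gns => -[pi1 piM iso] _ _ phiE.
have -> : word_vec s = pi (FreeGroup rs) xi by rewrite pi_xi.
have -> : word_vec t = pi (FreeGroup rt) xi by rewrite pi_xi.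
rewrite -(iso (FreeGroup rt)^-1%g) -!piM mulVg pi1 -phiE phi_funE //.
Qed.

Lemma dot_xi : dot xi xi = 1.
Proof. exact: (@dot_word_vec [::] [::]). Qed.

Lemma word_vec_total v : (forall s, reduced s -> dot v (word_vec s) = 0) -> v = 0.
Proof.
move=> h; case: gns => _ _ cyc _; apply: dense_orthogonal_eq0 cyc _ => // _ [m [c [g ->]]].
rewrite dot_sumr big1 // => i _; rewrite dotZr pi_xi h ?mulr0 //.
exact: word_reduced.
Qed.

Lemma dot_word_vec_xi s : reduced s -> dot (word_vec s) xi = phi_word s.
Proof. by move=> rs; rewrite (@dot_word_vec s [::]). Qed.

(** * Orthogonal decomposition by first letters *)

Definition gen_part s : H :=
  if s is x :: s' then if x.2 then phi_word s' *: word_vec [:: x] else 0 else 0.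

(* Locked, since otherwise rewriting with [dotBl] unfolds it. *)
Definition residue s : H := locked (word_vec s - phi_word s *: xi - gen_part s).

Lemma residueE s : residue s = word_vec s - phi_word s *: xi - gen_part s.
Proof. by rewrite /residue -lock. Qed.

Lemma word_vec_residue s : word_vec s = residue s + phi_word s *: xi + gen_part s.
Proof. by rewrite residueE addrAC !subrK. Qed.

Lemma residue_nil : residue [::] = 0.
Proof. by rewrite residueE scale1r subrr subr0. Qed.

Lemma residue_pos i s : residue (pos i :: s) = word_vec (pos i :: s) - phi_word s *: word_vec [:: pos i].
Proof. by rewrite residueE phi_word_pos // scale0r subr0. Qed.

Lemma phi_ker_gen x s : reduced s -> phi_ker [:: x] s =
  if s is y :: s' then if x == y then phi_word s'
  else if x.2 && y.2 then b * phi_word s' else 0 else phi_word [:: x].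
Proof.
case: s => [|y s] rs //; have [->|xy] := eqVneq x y.
  by rewrite phi_ker_cons /phi_ker word_mul1 ?phi_word_inv //; apply/word_inv_reduced/path_sorted/rs.
by rewrite phi_ker_diff //= ?xy // mul0r add0r (negPf xy) mul1r.
Qed.

Lemma phi_ker_gen_r x s : reduced s -> phi_ker s [:: x] =
  if s is y :: s' then if y == x then phi_word s'
  else if x.2 && y.2 then b * phi_word s' else 0 else phi_word [:: x].
Proof.
case: s => [|y s] rs //; have [->|xy] := eqVneq y x.
  by rewrite phi_ker_cons.
by rewrite phi_ker_diff //= ?xy // mulr0 add0r (negPf xy) mulr1 andbC.
Qed.

Lemma dot_residue_xi s : reduced s -> dot (residue s) xi = 0.
Proof.
move=> rs; rewrite residueE !dotE dot_word_vec_xi // dot_xi mulr1 subrr sub0r.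
case: s rs => [|[i []] s] rs; rewrite /= ?dot0l ?oppr0 //.
by rewrite dotZl dot_word_vec_xi // mulr0 oppr0.
Qed.

(** For $s=u_is'$ the inner product of $s\xi$ with $u_k\xi$ is $\phi(s')$ times that of $u_i\xi$
    with $u_k\xi$, so [gen_part] is the projection onto the span of the generator vectors. *)
Lemma dot_residue_gen s k : reduced s -> dot (residue s) (word_vec [:: pos k]) = 0.
Proof.
move=> rs; rewrite residueE !dotE dot_word_vec // phi_ker_gen_r //.
rewrite (@dot_word_vec [::] [:: pos k]) // phi_ker_gen_r // mulr0 subr0.
case: s rs => [|[i []] s] rs /=; rewrite ?dot0l ?subr0 //; last first.
  by rewrite xpair_eqE andbF.
rewrite dotZl (@dot_word_vec [:: pos i] [:: pos k]) // phi_ker_gen_r //=.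
by case: ifP => _; rewrite !mulr1 ?[b * _]mulrC subrr.
Qed.

(** Of the two terms in [phi_ker_diff], the projection onto [xi] removes the product and [gen_part]
    removes [gen_ker]. *)
Lemma dot_residue_residue s t : reduced s -> reduced t -> ~~ same_head s t ->
  dot (residue s) (residue t) = 0.
Proof.
move=> rs rt hd; rewrite [residue t]residueE !dotBr dotZr dot_residue_xi // mulr0 subr0.
have -> : dot (residue s) (gen_part t) = 0.
  by case: t {rt hd} => [|[k []] t] /=; rewrite ?dot0r // dotZr dot_residue_gen ?mulr0.
rewrite subr0 residueE !dotE dot_word_vec // phi_ker_diff // (@dot_word_vec [::] t) //.
have -> : phi_ker [::] t = phi_word t by rewrite /phi_ker word_mul1 ?phi_word_inv ?word_inv_reduced.
rewrite [phi_word s * phi_word t + _]addrC addrK.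
case: s rs hd => [|[i []] s] rs hd; rewrite /= ?dot0l ?subrr //; last first.
  by case: t {rt hd} => [|[k []] t]; rewrite subrr.
rewrite dotZl (@dot_word_vec [:: pos i] t) // phi_ker_gen //.
case: t rt hd => [|[k f] t] rt /= hd; first by rewrite mulr0 subrr.
by rewrite (negPf hd); case: f {rt hd} => /=; rewrite ?mulr0 ?subrr // mulrCA subrr.
Qed.

(** Its bipolar is the summand $N_i$ for [x = neg i] and $R_i$ for [x = pos i]. *)
Definition residues x : set H := [set z | exists2 s, reduced (x :: s) & z = residue (x :: s)].
Definition generators : set H := [set z | exists i, z = word_vec [:: pos i]].

Lemma dot_bip_residue x y u v : x != y -> bip (residues x) u -> bip (residues y) v ->
  dot u v = 0.
Proof.
move=> xy; apply: bipolar_orthogonal => _ _ [s rs ->] [t rt ->].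
by apply: dot_residue_residue.
Qed.

Lemma dot_bip_gen x u v : bip (residues x) u -> bip generators v -> dot u v = 0.
Proof.
apply: bipolar_orthogonal => _ _ [s rs ->] [k ->]; exact: dot_residue_gen.
Qed.

Lemma dot_bip_xi x u : bip (residues x) u -> dot u xi = 0.
Proof. by apply => _ [s rs ->]; apply: dot_residue_xi. Qed.

Lemma dot_gen_xi u : bip generators u -> dot u xi = 0.
Proof. by apply => _ [k ->]; rewrite dot_word_vec_xi. Qed.

Lemma bip_word_vec_gen i : bip generators (word_vec [:: pos i]).
Proof. by apply: sub_bipolar; exists i. Qed.

Lemma dot_bip_word_vec x u s : bip (residues x) u -> reduced s -> ~~ same_head [:: x] s ->
  dot u (word_vec s) = 0.
Proof.
move=> hu rs hd; rewrite word_vec_residue !dotE (dot_bip_xi hu) mulr0 addr0.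
have -> : dot u (gen_part s) = 0.
  case: s {rs hd} => [|[k []] s] /=; rewrite ?dot0r // dotZr.
  by rewrite (dot_bip_gen hu (bip_word_vec_gen k)) mulr0.
rewrite addr0; case: s rs hd => [|y s] rs hd; first by rewrite residue_nil dot0r.
by apply: (@dot_bip_residue x y) => //; apply: sub_bipolar; exists s.
Qed.

Lemma sum_dot_single x u (z : letter 'I_n -> H) :
  (forall y, y != x -> dot (z y) u = 0) ->
  \sum_i dot (z (neg i)) u + \sum_i dot (z (pos i)) u = dot (z x) u.
Proof.
case: x => i [] zx; last rewrite addrC.
  rewrite big1 ?add0r; last by move=> j _; apply: zx; rewrite xpair_eqE andbF.
  rewrite (bigD1 i) //= big1 ?addr0 // => j ji.
  by apply: zx; rewrite xpair_eqE (negPf ji).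
rewrite big1 ?add0r; last by move=> j _; apply: zx; rewrite xpair_eqE andbF.
rewrite (bigD1 i) //= big1 ?addr0 // => j ji.
by apply: zx; rewrite xpair_eqE (negPf ji).
Qed.

Definition expansion c k (z : letter 'I_n -> H) : H :=
  c *: xi + k + \sum_i z (neg i) + \sum_i z (pos i).

Lemma dot_expansion_residue c k (z : letter 'I_n -> H) x u :
  bip generators k -> (forall y, bip (residues y) (z y)) -> bip (residues x) u ->
  dot (expansion c k z) u = dot (z x) u.
Proof.
move=> Kk Dz Du; rewrite /expansion !dotDl dotZl !dot_suml.
rewrite (dot_eq0C (dot_bip_xi Du)) (dot_eq0C (dot_bip_gen Du Kk)) mulr0 !add0r.
by apply: sum_dot_single => y yx; apply: dot_bip_residue yx (Dz y) Du.
Qed.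

(** Project onto each summand separately. The remainder is orthogonal to [xi], the generators and
    all residues, hence to every word vector, so cyclicity makes it 0. *)
Lemma expansion_exists v : exists c k (z : letter 'I_n -> H), [/\ v = expansion c k z,
  bip generators k & forall x, bip (residues x) (z x)].
Proof.
have [k Kk vk] := projection_exists dotN generators v.
have /choice[z hz] : forall x, exists z, bip (residues x) z /\
    orthogonal_to dot (residues x) (v - z).
  by move=> x; have [z] := projection_exists dotN (residues x) v; exists z.
have Dz x : bip (residues x) (z x) by have [] := hz x.
exists (dot v xi), k, z; split=> //; apply/eqP; rewrite -subr_eq0; apply/eqP.
set c := dot v xi; set r := v - _.
have rxi : dot r xi = 0.
  rewrite /r /expansion !dotE dot_xi mulr1 (dot_gen_xi Kk) !dot_suml.
  rewrite !big1 ?addr0 ?subrr // => i _; exact: dot_bip_xi (Dz _).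
have rgen i : dot r (word_vec [:: pos i]) = 0.
  have vki : dot (v - k) (word_vec [:: pos i]) = 0 by apply/dot_eq0C/vk; exists i.
  have -> : r = v - k - (c *: xi + \sum_i z (neg i) + \sum_i z (pos i)).
    rewrite /r /expansion [c *: xi + k]addrC -!addrA opprD.
    by rewrite !addrA.
  rewrite dotBl vki !dotDl !dot_suml dotZl (dot_eq0C (dot_gen_xi (bip_word_vec_gen i))).
  rewrite mulr0 add0r !big1 ?addr0 ?oppr0 // => j _; apply: dot_bip_gen (Dz _) (bip_word_vec_gen i).
have rres x s : reduced (x :: s) -> dot r (residue (x :: s)) = 0.
  move=> rs; have Ds : bip (residues x) (residue (x :: s)) by apply: sub_bipolar; exists s.
  have vz : dot (v - z x) (residue (x :: s)) = 0.
    by apply: dot_eq0C; have [_] := hz x; apply; exists s.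
  by rewrite /r dotBl (dot_expansion_residue _ Kk Dz Ds) -dotBl.
apply: word_vec_total => s rs; rewrite word_vec_residue !dotDr dotZr rxi mulr0 addr0.
case: s rs => [|[i []] s] rs; rewrite /= ?residue_nil ?dot0r ?addr0 ?rres //.
by rewrite dotZr rgen mulr0 add0r.
Qed.

Lemma dot_expansion c c' k k' (z z' : letter 'I_n -> H) :
  bip generators k -> bip generators k' ->
  (forall x, bip (residues x) (z x)) -> (forall x, bip (residues x) (z' x)) ->
  dot (expansion c k z) (expansion c' k' z') =
  c * c'^* + dot k k' + \sum_i dot (z (neg i)) (z' (neg i))
  + \sum_i dot (z (pos i)) (z' (pos i)).
Proof.
move=> Kk Kk' Dz Dz'.
have sum_dot (e f : bool) : \sum_(i < n) dot (z (i, e)) (\sum_(j < n) z' (j, f)) =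
    if e == f then \sum_(i < n) dot (z (i, e)) (z' (i, f)) else 0.
  case: eqVneq => [<-|ef].
    apply: eq_bigr => i _; rewrite dot_sumr (bigD1 i) //= big1 ?addr0 // => j ji.
    by apply: dot_bip_residue (Dz _) (Dz' _); rewrite xpair_eqE eq_sym (negPf ji).
  rewrite big1 // => i _; rewrite dot_sumr big1 // => j _.
  by apply: dot_bip_residue (Dz _) (Dz' _); rewrite xpair_eqE (negPf ef) andbF.
have zx e : \sum_(i < n) dot (z (i, e)) xi = 0.
  by rewrite big1 // => i _; apply: dot_bip_xi (Dz _).
have zk e : \sum_(i < n) dot (z (i, e)) k' = 0.
  by rewrite big1 // => i _; apply: dot_bip_gen (Dz _) Kk'.
have xz e : dot xi (\sum_(i < n) z' (i, e)) = 0.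
  by rewrite dot_sumr big1 // => i _; apply/dot_eq0C/dot_bip_xi/Dz'.
have kz e : dot k (\sum_(i < n) z' (i, e)) = 0.
  by rewrite dot_sumr big1 // => i _; apply/dot_eq0C/(dot_bip_gen (Dz' _) Kk).
rewrite /expansion !dotDl !dotDr !dotZl !dotZr !dot_suml !sum_dot !zk !xz !kz /=.
rewrite !zx dot_xi (dot_gen_xi Kk) (dot_eq0C (dot_gen_xi Kk')).
by rewrite !(mulr0, mulr1, addr0, add0r).
Qed.

Lemma expansionB c c' k k' (z z' : letter 'I_n -> H) :
  expansion c k z - expansion c' k' z' =
  expansion (c - c') (k - k') (fun x => z x - z' x).
Proof.
rewrite /expansion !sumrB scalerBl.
by do 3!(rewrite opprD addrACA; congr (_ + _)).
Qed.

Lemma expansion_eq0 c k (z : letter 'I_n -> H) :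
  bip generators k -> (forall x, bip (residues x) (z x)) -> expansion c k z = 0 ->
  [/\ c = 0, k = 0 & forall x, z x = 0].
Proof.
move=> Kk Dz /(congr1 (fun v => dot v v)); rewrite dot0l dot_expansion // -normCK.
have S0 e : 0 <= \sum_(i < n) dot (z (i, e)) (z (i, e)).
  by apply: sumr_ge0 => i _; apply: dot_ge0.
have c0 : 0 <= `|c| ^+ 2 by rewrite exprn_ge0.
have k0 := dot_ge0 dot k.
case/padd_eq0; rewrite ?addr_ge0 // => + pz.
case/padd_eq0; rewrite ?addr_ge0 // => + nz.
case/padd_eq0 => // /eqP; rewrite sqrf_eq0 normr_eq0 => /eqP -> /dot_eq0 ->.
split=> // -[i []]; apply/(@dot_eq0 _ _ dot).
  exact: (psum_eq0 (fun i => dot_ge0 dot (z (pos i))) pz).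
exact: (psum_eq0 (fun i => dot_ge0 dot (z (neg i))) nz).
Qed.

Lemma expansion_inj c c' k k' (z z' : letter 'I_n -> H) :
  bip generators k -> bip generators k' ->
  (forall x, bip (residues x) (z x)) -> (forall x, bip (residues x) (z' x)) ->
  expansion c k z = expansion c' k' z' -> [/\ c = c', k = k' & forall x, z x = z' x].
Proof.
move=> Kk Kk' Dz Dz' /eqP; rewrite -subr_eq0 expansionB => /eqP.
case/expansion_eq0; [exact: bipolarB|by move=> x; apply: bipolarB|].
move=> /eqP; rewrite subr_eq0 => /eqP -> /eqP; rewrite subr_eq0 => /eqP -> zz.
by split=> // x; apply/eqP; rewrite -subr_eq0; apply/eqP/zz.
Qed.

(** * Action of the generators on the summands *)

Lemma bip_map x (D1 D2 : set H) u : (forall z, D1 z -> bip D2 (act x z)) ->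
  bip D1 u -> bip D2 (act x u).
Proof.
(* Moving [act x] to the other side reduces the claim to the spanning set; this replaces a
   continuity argument. *)
move=> h hu y D2y; rewrite act_adjoint; apply: hu => z /h.
by rewrite -act_adjoint; apply.
Qed.

Lemma bip_act_residue i x u : x != neg i -> bip (residues x) u ->
  bip (residues (pos i)) (act (pos i) u).
Proof.
move=> xi'; apply: bip_map => _ [s rs ->].
have rx t : reduced (x :: t) -> reduced [:: pos i, x & t].
  by rewrite /reduced /= => ->; rewrite andbT.
have mem t : reduced (x :: t) -> bip (residues (pos i)) (residue [:: pos i, x & t]).
  by move=> /rx rt; apply: sub_bipolar; exists (x :: t).
(* Applying $u_i$ turns the [xi] term into the generator term of the longer word, and $u_ix\xi$ with
   [x] positive is its own residue. *)
have -> : act (pos i) (residue (x :: s)) =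
    residue [:: pos i, x & s] - (if x.2 then phi_word s *: residue [:: pos i; x] else 0).
  rewrite [residue (x :: s)]residueE residue_pos !linearB linearZ /=; congr (_ - _).
  case: ifP => x2; last by rewrite linear0.
  by rewrite linearZ residue_pos phi_word_pos // scale0r subr0.
apply: bipolarB; first exact: mem.
by case: ifP => _; [apply/bipolarZ/mem|apply: bipolar0].
Qed.

Lemma bip_act_gen i u : bip generators u -> bip (residues (pos i)) (act (pos i) u).
Proof.
apply: bip_map => _ [j ->]; apply: sub_bipolar; exists [:: pos j].
  by rewrite /reduced /= xpair_eqE andbF.
by rewrite residue_pos phi_word_pos // scale0r subr0.
Qed.

(** The residue of $u_is$ is $u_i(s\xi-\phi(s)\xi)$, and [s] does not start with $u_i^{-1}$, so both
    vectors in the bracket are orthogonal to [u]. *)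
Lemma dot_act_neg i u r : bip (residues (neg i)) u -> bip (residues (pos i)) r ->
  dot (act (pos i) u) r = 0.
Proof.
move=> hu hr; apply: dot_eq0C; apply: hr => _ [s rs ->].
have rs' : reduced s by apply: path_sorted rs.
rewrite residue_pos !word_vec_cons -linearZ -linearB act_isometry; apply: dot_eq0C.
rewrite dotBr dotZr (dot_bip_xi hu) mulr0 subr0 (dot_bip_word_vec hu) //.
by case: s rs {rs'} => //= y s /andP[]; rewrite eq_sym.
Qed.

(** * The eigenvalue equation in components *)

Let n1_gt0 : 0 < n%:R - 1 :> C.
Proof. exact: natr_sub1_gt0. Qed.

(** Each row of the Gram matrix sums to $1+(n-1)b=0$. *)
Lemma sum_gen : \sum_i word_vec [:: pos i] = 0.
Proof.
apply: (@dot_eq0 _ _ dot); rewrite dot_suml big1 // => i _; rewrite dot_sumr.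
under eq_bigr => j _ do rewrite dot_word_vec // phi_ker_gen //= mulr1 xpair_eqE andbT.
rewrite (bigD1 i) //= eqxx; under eq_bigr => j ji do rewrite eq_sym (negPf ji).
rewrite (eq_bigl [in predC1 i]) // sumr_const cardC1 card_ord -mulr_natr.
rewrite -subn1 natrB ?(ltnW hn) // /b mulN1r mulNr mulVf ?subrr //.
by rewrite gt_eqF // n1_gt0.
Qed.

(* [z x] is the component of an eigenvector attached to the first letter [x];
   [zz i x] is that of [act (pos i) (z (neg i))]. *)
Section EigenvectorExpansion.
Variables (a c : C) (k : H) (z : letter 'I_n -> H).
Variables (al : 'I_n -> C) (kk : 'I_n -> H) (zz : 'I_n -> letter 'I_n -> H).
Let e i := k + \sum_(j < n) z (neg j) + \sum_(j < n) z (pos j) - z (neg i).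
Let f i := act (pos i) (e i).
Hypotheses (Kk : bip generators k) (Dz : forall x, bip (residues x) (z x)).
Hypotheses (Kkk : forall i, bip generators (kk i))
  (Dzz : forall i x, bip (residues x) (zz i x)).
Arguments Dz : clear implicits.
Arguments Dzz : clear implicits.
Hypothesis zz_diag : forall i, zz i (pos i) = 0.
Hypothesis act_zE : forall i, act (pos i) (z (neg i)) = expansion (al i) (kk i) (zz i).
(** The four equations compare components in $(\sum_iu_i)v=av$. The vectors $c\,u_i\xi$ cancel by
    [sum_gen], and [f j] lies wholly in $R_j$. *)
Hypothesis a_c : a * c = \sum_i al i.
Hypothesis a_k : a *: k = \sum_i kk i.
Hypothesis a_neg : forall j, a *: z (neg j) = \sum_i zz i (neg j).
Hypothesis a_pos : forall j, a *: z (pos j) = \sum_i zz i (pos j) + f j.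

Let tau : C := `|a| ^+ 2 / n%:R.
Let vN := \sum_(j < n) z (neg j).
Let nN i := \sum_(j < n) zz i (neg j).
Let g j := \sum_i zz i (pos j).
Let X : C := \sum_(j < n) dot (z (neg j)) (z (neg j)).
Let Y : C := \sum_(j < n) dot (z (pos j)) (z (pos j)).
Let N : C := \sum_i dot (nN i) (nN i).
Let P : C := \sum_i (`|al i| ^+ 2 + dot (kk i) (kk i)).
Let Q : C := \sum_i \sum_j dot (zz i (pos j)) (zz i (pos j)).
Let G : C := \sum_j dot (g j) (g j).

Let n_gt0 : 0 < n%:R :> C. Proof. by rewrite ltr0n ltnW. Qed.
Let nN0 : n%:R != 0 :> C. Proof. by rewrite gt_eqF. Qed.

Let dot_sum_same (F : 'I_n -> H) (t : bool) : (forall i, bip (residues (i, t)) (F i)) ->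
  dot (\sum_i F i) (\sum_i F i) = \sum_i dot (F i) (F i).
Proof.
move=> DF; rewrite dot_suml; apply: eq_bigr => i _.
rewrite dot_sumr (bigD1 i) //= big1 ?addr0 // => j ji.
by apply: dot_bip_residue (DF _) (DF _); rewrite xpair_eqE eq_sym (negPf ji).
Qed.

(** The map [act (pos i)] preserves the norm of [z (neg i)]. *)
Lemma energy_neg : X = P + N + Q.
Proof.
rewrite /P /N /Q -!big_split /=; apply: eq_bigr => i _.
rewrite -(act_isometry (pos i)) act_zE dot_expansion // -normCK; congr (_ + _ + _).
by rewrite /nN (dot_sum_same (t := false)).
Qed.

(** A variance: by [a_neg] the vectors [nN i] have mean [(a / n%:R) *: vN]. *)
Lemma energy_mean : \sum_i dot (nN i - (a / n%:R) *: vN) (nN i - (a / n%:R) *: vN) = N - tau * X.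
Proof.
have sN : \sum_i nN i = a *: vN.
  by rewrite /nN exchange_big scaler_sumr; apply: eq_bigr => j _; rewrite a_neg.
have vX : dot vN vN = X by apply: (dot_sum_same (t := false)).
have -> : \sum_i dot (nN i - (a / n%:R) *: vN) (nN i - (a / n%:R) *: vN) =
    N - (dot (\sum_i nN i) ((a / n%:R) *: vN) + dot ((a / n%:R) *: vN) (\sum_i nN i))
    + \sum_(i < n) dot ((a / n%:R) *: vN) ((a / n%:R) *: vN).
  rewrite dot_suml dot_sumr /N -big_split -sumrB -big_split /=.
  by apply: eq_bigr => i _; rewrite !dotBl !dotBr; ring.
rewrite sumr_const card_ord -[X in _ + X]mulr_natl.
rewrite sN !dotZl !dotZr vX conj_divn /tau normCK; field; exact: nN0.
Qed.

(** Each [f i] has the norm of [e i], and each [z (neg j)] is left out of exactly one [e i]. *)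
Lemma energy_f : \sum_j dot (f j) (f j) = n%:R * dot k k + (n%:R - 1) * X + n%:R * Y.
Proof.
have vX : dot vN vN = X by apply: (dot_sum_same (t := false)).
have fE i : dot (f i) (f i) = dot k k + X + Y - dot (z (neg i)) (z (neg i)).
  pose z' x := if x == neg i then 0 else z x.
  have Dz' x : bip (residues x) (z' x).
    by rewrite /z'; case: eqP => _ //; apply: bipolar0.
  have z'p j : z' (pos j) = z (pos j) by rewrite /z' xpair_eqE andbF.
  have z'n j : j != i -> z' (neg j) = z (neg j) by move=> ji; rewrite /z' xpair_eqE (negPf ji).
  have z'i : z' (neg i) = 0 by rewrite /z' eqxx.
  have eE : e i = expansion 0 k z'.
    rewrite /e /expansion scale0r add0r addrAC; congr (_ + _).
      rewrite -addrA; congr (_ + _).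
      rewrite (bigD1 i) //= [in RHS](bigD1 i) //= z'i add0r addrAC subrr add0r.
      by apply: eq_bigr => j ji; rewrite z'n.
    by apply: eq_bigr => j _; rewrite z'p.
  rewrite /f act_isometry eE dot_expansion // mul0r add0r.
  under [X in _ + X = _]eq_bigr => j _ do rewrite z'p.
  rewrite -/Y /X (bigD1 i) //= [in RHS](bigD1 i) //= z'i dot0l.
  under eq_bigr => j ji do rewrite z'n //.
  by ring.
under eq_bigr => i _ do rewrite fE.
rewrite sumrB sumr_const card_ord -/X -mulr_natl; ring.
Qed.

(** By [a_pos], [g j = a *: z (pos j) - f j]; its squared norm supplies the cross terms of the
    left-hand square. *)
Lemma energy_pos :
  n%:R * \sum_j dot (z (pos j) - (a^* / n%:R) *: f j) (z (pos j) - (a^* / n%:R) *: f j) =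
  n%:R * (1 - tau) * Y + G - (1 - tau) * \sum_j dot (f j) (f j).
Proof.
rewrite /G /Y !mulr_sumr -big_split -sumrB /=; apply: eq_bigr => j _.
have -> : g j = a *: z (pos j) - f j by rewrite a_pos addrK.
rewrite !dotBl !dotBr !dotZl !dotZr conj_divn conjCK /tau normCK.
by field; exact: nN0.
Qed.

(** The deficit in Cauchy-Schwarz for [g j], a sum of only $n-1$ vectors because of [zz_diag]. *)
Lemma energy_slack : (n%:R - 1) * \sum_j \sum_(i | i != j)
    dot (zz i (pos j) - (n%:R - 1)^-1 *: g j) (zz i (pos j) - (n%:R - 1)^-1 *: g j) =
  (n%:R - 1) * Q - G.
Proof.
have m0 : n%:R - 1 != 0 :> C by rewrite gt_eqF // n1_gt0.
rewrite /Q exchange_big /G !mulr_sumr -sumrB; apply: eq_bigr => j _ /=.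
have gE : g j = \sum_(i | i != j) zz i (pos j).
  by rewrite /g (bigD1 j) //= zz_diag add0r.
rewrite [in RHS](bigD1 j) //= zz_diag dot0l add0r.
set m := (n%:R - 1)^-1.
have mr : m^* = m by apply: conj_inv_pred.
have -> : \sum_(i | i != j) dot (zz i (pos j) - m *: g j) (zz i (pos j) - m *: g j) =
    \sum_(i | i != j) dot (zz i (pos j)) (zz i (pos j))
    - (dot (\sum_(i | i != j) zz i (pos j)) (m *: g j) + dot (m *: g j) (\sum_(i | i != j) zz i (pos j)))
    + \sum_(i < n | i != j) dot (m *: g j) (m *: g j).
  rewrite dot_suml dot_sumr -big_split -sumrB -big_split /=.
  by apply: eq_bigr => i _; rewrite !dotBl !dotBr; ring.
rewrite (eq_bigl [in predC1 j] (fun=> dot (m *: _) _)) // sumr_const cardC1 card_ord.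
rewrite -[_ *+ n.-1]mulr_natl -subn1 natrB ?(ltnW hn) //.
rewrite -gE !dotZl !dotZr mr /m; field; exact: m0.
Qed.

(* For tau < 1 every summand is nonnegative, hence 0; for tau >= 1,
   [energy_neg] and [energy_mean] force [P = 0] and then [k = 0]. *)
Lemma energy_total :
  n%:R * \sum_j dot (z (pos j) - (a^* / n%:R) *: f j) (z (pos j) - (a^* / n%:R) *: f j)
  + (n%:R - 1) * \sum_i dot (nN i - (a / n%:R) *: vN) (nN i - (a / n%:R) *: vN)
  + (n%:R - 1) * P
  + (n%:R - 1) * \sum_j \sum_(i | i != j)
    dot (zz i (pos j) - (n%:R - 1)^-1 *: g j) (zz i (pos j) - (n%:R - 1)^-1 *: g j)
  + (1 - tau) * (n%:R * dot k k) = 0.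
Proof.
rewrite energy_pos energy_mean energy_slack energy_f energy_neg; ring.
Qed.

Let sum_dot_ge0 (I : finType) (p : pred I) (F : I -> H) : 0 <= \sum_(i | p i) dot (F i) (F i).
Proof. by apply: sumr_ge0 => i _; apply: dot_ge0. Qed.

Let P_ge0 : 0 <= P.
Proof. by apply: sumr_ge0 => i _; rewrite addr_ge0 ?exprn_ge0 ?dot_ge0. Qed.

Let P_eq0 : P = 0 -> forall i, al i = 0 /\ kk i = 0.
Proof.
move=> P0 i; have F0 j : 0 <= `|al j| ^+ 2 + dot (kk j) (kk j).
  by rewrite addr_ge0 ?exprn_ge0 ?dot_ge0.
have [||/eqP] := padd_eq0 _ _ (psum_eq0 F0 P0 i); [by rewrite exprn_ge0|exact: dot_ge0|].
by rewrite sqrf_eq0 normr_eq0 => /eqP -> /dot_eq0.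
Qed.

Let k_eq0 : k = 0.
Proof.
have tr : tau \is Num.real by rewrite ger0_real // divr_ge0 ?exprn_ge0.
have [tau1|tau1] := real_ltP tr (real1 _).
  have t0 : 0 < 1 - tau by rewrite subr_gt0.
  have := energy_total; case/padd_eq0.
  - by rewrite !addr_ge0 ?mulr_ge0 ?(ltW n1_gt0) ?sum_dot_ge0 // sumr_ge0.
  - by rewrite !mulr_ge0 ?(ltW t0) ?dot_ge0.
  by move=> _ /eqP; rewrite !mulf_eq0 (gt_eqF t0) (negPf nN0) /= => /eqP/dot_eq0.
have a0 : a != 0.
  by apply/eqP => a0; move: tau1; rewrite /tau a0 normr0 expr0n mul0r ler10.
have P0 : P = 0.
  apply/eqP; rewrite eq_le P_ge0 andbT.
  have Q0 : 0 <= Q by rewrite /Q sumr_ge0.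
  have := energy_mean; have -> : N = X - P - Q by rewrite energy_neg; ring.
  move=> ES; have PE : P + (\sum_i dot (nN i - (a / n%:R) *: vN) (nN i - (a / n%:R) *: vN) + Q)
      = (1 - tau) * X by rewrite ES; ring.
  apply: le_trans (_ : (1 - tau) * X <= 0); last first.
    by rewrite mulr_le0_ge0 ?subr_le0 // /X sum_dot_ge0.
  by rewrite -PE lerDl addr_ge0 ?sum_dot_ge0.
have : a *: k = 0 by rewrite a_k big1 // => i _; have [] := P_eq0 P0 i.
by move/eqP; rewrite scaler_eq0 (negPf a0) => /eqP.
Qed.

(** With [k = 0] the only summand of [energy_total] whose sign depends on [tau] is gone, so all the
    others vanish. *)
Let equality_case : [/\ forall i, al i = 0 /\ kk i = 0,
  forall j, z (pos j) = (a^* / n%:R) *: f j,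
  forall i, nN i = (a / n%:R) *: vN &
  forall i j, i != j -> zz i (pos j) = (n%:R - 1)^-1 *: g j].
Proof.
have m0 := n1_gt0; have mN0 : n%:R - 1 != 0 :> C by rewrite gt_eqF.
have := energy_total; rewrite k_eq0 dot0l !mulr0 addr0.
have S0 : 0 <= \sum_j \sum_(i | i != j)
    dot (zz i (pos j) - (n%:R - 1)^-1 *: g j) (zz i (pos j) - (n%:R - 1)^-1 *: g j).
  by rewrite sumr_ge0.
have cancel0 (p q : C) : p != 0 -> p * q = 0 -> q = 0.
  by move=> p0 /eqP; rewrite mulf_eq0 (negPf p0) => /eqP.
case/padd_eq0; rewrite ?addr_ge0 ?mulr_ge0 ?(ltW m0) ?sum_dot_ge0 //.
move=> + /(cancel0 _ _ mN0) zz0.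
case/padd_eq0; rewrite ?addr_ge0 ?mulr_ge0 ?(ltW m0) ?sum_dot_ge0 //.
move=> + /(cancel0 _ _ mN0) P0.
case/padd_eq0; rewrite ?mulr_ge0 ?(ltW m0) ?sum_dot_ge0 //.
move=> /(cancel0 _ _ nN0) z0 /(cancel0 _ _ mN0) N0.
have sub0 u v : dot (u - v) (u - v) = 0 -> u = v by move/dot_eq0/eqP; rewrite subr_eq0 => /eqP.
split.
- exact: P_eq0.
- by move=> j; apply: sub0; apply: (psum_eq0 _ z0) => i; apply: dot_ge0.
- by move=> j; apply: sub0; apply: (psum_eq0 _ N0) => i; apply: dot_ge0.
move=> i j ij; apply: sub0; have /psumr_eq0P := psum_eq0 (fun j => sum_dot_ge0 _ _) zz0 j.
by apply => // l _; apply: dot_ge0.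
Qed.

Let w := vN + \sum_j z (pos j).

Let w_head x s : reduced (x :: s) -> dot w (word_vec (x :: s)) = dot (z x) (word_vec (x :: s)).
Proof.
move=> rs; have zx y : y != x -> dot (z y) (word_vec (x :: s)) = 0.
  by move=> yx; apply: (dot_bip_word_vec (Dz y) rs).
by rewrite /w /vN dotDl !dot_suml (sum_dot_single zx).
Qed.

(** Cancel $u_i$ on both sides; the missing component [z (neg i)] does not see [s], which cannot
    start with $u_i^{-1}$. *)
Let f_ev i s : reduced (pos i :: s) -> dot (f i) (word_vec (pos i :: s)) = dot w (word_vec s).
Proof.
move=> rs; have rs' : reduced s by apply: path_sorted rs.
rewrite word_vec_cons /f act_isometry /e k_eq0 add0r dotBl -/vN -/w.
rewrite [X in _ - X](dot_bip_word_vec (Dz _)) ?subr0 //.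
by case: s rs {rs'} => //= y s /andP[]; rewrite eq_sym.
Qed.

Let w_ev s : reduced s -> dot w (word_vec s) = 0.
Proof.
have [alkk zf nNv zzg] := equality_case.
have [m] := ubnP (size s); elim: m s => // m IH [|[i []] s] sm rs.
- rewrite /w /vN dotDl !dot_suml !big1 ?addr0 // => i _; exact: dot_bip_xi (Dz _).
- by rewrite w_head // zf dotZl f_ev // IH ?mulr0 //; apply: path_sorted rs.
have rs' : reduced s by apply: path_sorted rs.
(* Applying $u_i$ to both sides strips the first letter $u_i^{-1}$, leaving the expansion of $u_iz$
   paired with the shorter word. *)
rewrite w_head // -(act_isometry (pos i)) word_vec_cons (act_invK (pos i)) act_zE.
have [-> ->] := alkk i; rewrite /expansion scale0r !add0r -/(nN i) nNv.
rewrite dotDl dotZl.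
case: s sm rs rs' => [|[j []] s] sm rs rs'.
- rewrite !dot_suml !big1 ?mulr0 ?addr0 // => j _; first exact: dot_bip_xi (Dzz _ _).
  exact: dot_bip_xi (Dz _).
- have ij : i != j by apply: contraTneq rs => ->; rewrite /= eqxx.
  rewrite !dot_suml big1 ?mulr0 ?add0r; last first.
    by move=> l _; apply: (dot_bip_word_vec (Dz _) rs'); rewrite /= xpair_eqE andbF.
  rewrite (bigD1 j) //= big1 ?addr0; last first.
    by move=> l lj; apply: (dot_bip_word_vec (Dzz _ _) rs'); rewrite /= xpair_eqE (negPf lj).
  (* Here [zzg] needs [ij]. The first pairing equals that of [w] with the same word and the second,
     by [f_ev], that of [w] with [s], so induction covers both. *)
  have -> : dot (zz i (pos j)) (word_vec (pos j :: s)) = (n%:R - 1)^-1 *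
      (a * dot (z (pos j)) (word_vec (pos j :: s)) - dot (f j) (word_vec (pos j :: s))).
    by rewrite zzg // dotZl -[in RHS]dotZl -dotBl a_pos addrK.
  have rs'' : reduced s by apply: path_sorted rs'.
  by rewrite -w_head // f_ev // !IH ?mulr0 ?subrr ?mulr0 //; move: sm => /=; lia.
rewrite [X in _ + X]dot_suml [X in _ + X]big1 ?addr0; last first.
  by move=> l _; apply: (dot_bip_word_vec (Dzz _ _) rs'); rewrite /= xpair_eqE andbF.
have -> : dot vN (word_vec (neg j :: s)) = dot w (word_vec (neg j :: s)).
  rewrite /w dotDl [X in _ + X]dot_suml [X in _ + X]big1 ?addr0 // => l _.
  by apply: (dot_bip_word_vec (Dz _) rs'); rewrite /= xpair_eqE andbF.
by rewrite IH ?mulr0.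
Qed.

Lemma eigenvector_expansion : expansion c k z = c *: xi /\ a * c = 0.
Proof.
have [alkk _ _ _] := equality_case; split.
  by rewrite /expansion k_eq0 addr0 -addrA -/vN -/w (word_vec_total w_ev) addr0.
by rewrite a_c big1 // => i _; have [] := alkk i.
Qed.

End EigenvectorExpansion.

(** * Eigenvectors and the eigenspace of zero *)

Lemma eigenvectorE a v : gen_sum pi v = a *: v -> exists2 c, v = c *: xi & a * c = 0.
Proof.
move=> Av; have [c [k [z [vE Kk Dz]]]] := expansion_exists v.
have /choice[al /choice[kk /choice[zz hzz]]] : forall i, exists al k' (z' : letter 'I_n -> H),
    [/\ act (pos i) (z (neg i)) = expansion al k' z',
        bip generators k' & forall x, bip (residues x) (z' x)].
  by move=> i; apply: expansion_exists.
have act_zE i : act (pos i) (z (neg i)) = expansion (al i) (kk i) (zz i) by have [] := hzz i.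
have Kkk i : bip generators (kk i) by have [] := hzz i.
have Dzz i x : bip (residues x) (zz i x) by have [] := hzz i.
pose e i := k + \sum_(j < n) z (neg j) + \sum_(j < n) z (pos j) - z (neg i).
have Df i : bip (residues (pos i)) (act (pos i) (e i)).
  have -> : e i = k + \sum_(j < n | j != i) z (neg j) + \sum_j z (pos j).
    rewrite /e (bigD1 i) //= addrAC; congr (_ + _).
    by rewrite [z (neg i) + _]addrC addrA addrK.
  rewrite !linearD !linear_sum /=.
  apply: bipolarD; first apply: bipolarD; first exact: bip_act_gen.
    apply: bipolar_sum => j ji; apply: bip_act_residue (Dz _).
    by rewrite xpair_eqE (negPf ji).
  by apply: bipolar_sum => j _; apply: bip_act_residue (Dz _); rewrite xpair_eqE andbF.
have zz_diag i : zz i (pos i) = 0.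
  apply: (@dot_eq0 _ _ dot).
  rewrite -(dot_expansion_residue (al i) (Kkk i) (Dzz i) (Dzz i _)) -act_zE.
  exact: dot_act_neg (Dz _) (Dzz _ _).
(* Extended by 0 to negative letters, so that the image of [v] is a single [expansion] and
   uniqueness applies. *)
pose f' x := if x.2 then act (pos x.1) (e x.1) else 0.
have AvE : gen_sum pi v =
    expansion (\sum_i al i) (\sum_i kk i) (fun x => \sum_i zz i x + f' x).
  have -> : gen_sum pi v = c *: (\sum_i word_vec [:: pos i]) +
      \sum_i expansion (al i) (kk i) (zz i) + \sum_i act (pos i) (e i).
    rewrite scaler_sumr -!big_split /=; apply: eq_bigr => i _.
    rewrite -act_zE word_vec_cons -linearZ -!linearD; congr (pi _ _).
    by rewrite vE /expansion /e -[RHS]addrA [z (neg i) + _]addrC subrK !addrA.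
  rewrite sum_gen scaler0 add0r /expansion !big_split /= -scaler_suml.
  rewrite [in RHS](big1 _ _ (fun i => f' (neg i))) // addr0 -!addrA.
  by rewrite exchange_big [X in _ + (_ + (_ + (X + _)))]exchange_big.
have /expansion_inj : expansion (a * c) (a *: k) (fun x => a *: z x) =
    expansion (\sum_i al i) (\sum_i kk i) (fun x => \sum_i zz i x + f' x).
  rewrite -AvE Av vE /expansion !scalerDr scalerA; congr (_ + _ + _ + _).
    by rewrite scaler_sumr.
  by rewrite scaler_sumr.
case.
- exact: bipolarZ.
- exact: bipolar_sum.
- by move=> x; apply: bipolarZ.
- move=> -[i []]; apply: bipolarD; rewrite ?/f' /=; [exact: bipolar_sum|exact: Df|exact: bipolar_sum|exact: bipolar0].
move=> ac ak az.
have [] := @eigenvector_expansion a c k z al kk zz Kk Dz Kkk Dzz zz_diag act_zE ac ak.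
- by move=> j; rewrite (az (neg j)) addr0.
- by move=> j; rewrite (az (pos j)).
by move=> vE' ac0; exists c => //; rewrite vE.
Qed.

Lemma gen_sum_eigen :
  (forall a : C, is_eigenvalue (gen_sum pi) a <-> a = 0) /\
  one_dimensional (eigenspace_of (gen_sum pi) 0).
Proof.
have xi0 : xi != 0 by apply/eqP => x0; have := dot_xi; rewrite x0 dot0l => /esym/eqP; rewrite oner_eq0.
(* [sum_gen] says that the operator kills [xi]. *)
have Axi (c : C) : gen_sum pi (c *: xi) = 0 *: (c *: xi).
  rewrite scale0r -[RHS](scaler0 _ c) -sum_gen scaler_sumr; apply: eq_bigr => i _.
  by rewrite linearZ.
split.
  move=> a; split=> [[v v0 /eigenvectorE[c vE /eqP]]|->].
    rewrite mulf_eq0 => /orP[/eqP //|/eqP c0].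
    by rewrite vE c0 scale0r eqxx in v0.
  by exists xi => //; rewrite /eigenspace_of /= -[xi]scale1r Axi.
exists xi => //; apply/seteqP; split=> [v /eigenvectorE[c -> _]|_ [c _ <-]].
  by exists c.
exact: Axi.
Qed.

End Decomposition.

Theorem proposition2p5 (R : realType) (n : nat) (hn : (2 <= n)%N) :
  positive_definite (@phi_fun R[i] n) /\
  forall (H : completeNormedModType R[i]) (dot : {dot H for Num.conj})
         (pi : free_group 'I_n -> {linear H -> H}) (xi : H),
    norm_from_dot dot ->
    GNS_rep dot pi (@phi_fun R[i] n) xi ->
    (forall a : R[i], is_eigenvalue (gen_sum pi) a <-> a = 0) /\
    one_dimensional (eigenspace_of (gen_sum pi) 0).
Proof.
split; first exact: phi_fun_pd.
by move=> H dot pi xi dotN gns; apply: gen_sum_eigen dotN gns.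
Qed.
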